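(* With the problem (LDR) and the feasible set $\mathcal F_M$ defined in the context, the following 0-1 semidefinite program is a conservative approximation of (LDR), i.e. its optimal value is an upper bound on that of (LDR): $$\min\ w^\top x+r+t$$ over $(Q,q,r,t,Y,y_0,p_0,\lambda,T,\Lambda,(\theta_i,\Gamma_i,\omega_i,\rho_i)_{i=1}^d,x)\in\mathcal F_M$ and $\tau\in\mathbb R^l$, subject to $\tau\ge0$ and $$\begin{bmatrix} Q-\tfrac12\big(N+N^\top\big) & g\\ g^\top & r-\sum_{i=1}^d b_i^\top\omega_i-b_0^\top p_0-c_0^\top y_0+\tau^\top h\end{bmatrix}\succeq0,$$ where $$N=\sum_{i=1}^d\Gamma_i+B_0^\top TW+C^\top Y,$$ $$g=\tfrac12\Big(q-\sum_{i=1}^d B_i^\top\omega_i-B_0^\top p_0-\sum_{i=1}^d\rho_i-(TW)^\top b_0-C^\top y_0-Y^\top c_0-W^\top\tau\Big).$$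
   Context: Data. $\mathcal X\subseteq\{0,1\}^d$, $w\in\mathbb R^d$, $A\in\mathbb R^{m\times n}$; $c(\xi)=C\xi+c_0$, $v(\xi)=V\xi+v_0$ with $C,V\in\mathbb R^{n\times k}$, $c_0,v_0\in\mathbb R^n$; $b_x(\xi)=B_x\xi+b_{x0}$ with $B_x=\sum_{i=1}^dB_ix_i+B_0$, $b_{x0}=\sum_{i=1}^db_ix_i+b_0$, $B_i\in\mathbb R^{m\times k}$, $b_i\in\mathbb R^m$. The support set is $\mathcal S=\{\xi\in\mathbb R^k: W\xi\ge h\}$, $W\in\mathbb R^{l\times k}$, $h\in\mathbb R^l$, assumed compact. $\mu_0\in\mathbb R^k$, $\Sigma_0\in\mathbb R^{k\times k}$ symmetric positive definite (empirical mean and covariance), $\gamma_1\ge0$, $\gamma_2\ge1$. The ambiguity set $\mathcal D_M$ is the set of all probability measures $F$ with $\mathbb P_F(\xi\in\mathcal S)=1$, $(\mathbb E_F[\xi]-\mu_0)^\top\Sigma_0^{-1}(\mathbb E_F[\xi]-\mu_0)\le\gamma_1$, $\mathbb E_F[(\xi-\mu_0)(\xi-\mu_0)^\top]\preceq\gamma_2\Sigma_0$. Standing assumptions. $c(\xi),v(\xi),b_x(\xi)$ are square-integrable under every $F\in\mathcal D_M$, and for every $x\in\mathcal X$ and $F\in\mathcal D_M$ the set $\{y\in\mathbb R^n:Ay\le b_x(\xi)\}$ is almost surely nonempty and bounded. Problem (LDR) (linear decision rules $y(\xi)=Y\xi+y_0$, $p(\xi)=P\xi+p_0$): $$\min_{x\in\mathcal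 X,\ \lambda\ge0,\ P\in\mathbb R^{m\times k},\ p_0\in\mathbb R^m,\ Y\in\mathbb R^{n\times k},\ y_0\in\mathbb R^n}\ w^\top x+\sup_{F\in\mathcal D_M}\mathbb E_F[b_x(\xi)^\top p(\xi)+c(\xi)^\top y(\xi)]$$ subject to $A^\top p(\xi)+\lambda c(\xi)=v(\xi)$, $p(\xi)\ge0$, $Ay(\xi)\le\lambda b_x(\xi)$ for all $\xi\in\mathcal S$. The set $\mathcal F_M$. Let $M>0$ be a sufficiently large (big-M) constant; $\mathbf 1_r$ is the all-ones vector in $\mathbb R^r$, $\mathbf 1_{k\times k}$ the all-ones matrix; vector/matrix inequalities $\le,\ge$ are entrywise; $X\cdot Y=\mathrm{Tr}(X^\top Y)$; $\|\cdot\|$ is the Euclidean norm. $\mathcal F_M$ is the set of tuples with $Q\in\mathbb R^{k\times k}$ symmetric, $q\in\mathbb R^k$, $r,t,\lambda\in\mathbb R$, $Y\in\mathbb R^{n\times k}$, $y_0\in\mathbb R^n$, $p_0\in\mathbb R^m$, $T,\Lambda\in\mathbb R^{m\times l}$, $\theta_i\in\mathbb R$, $\Gamma_i\in\mathbb R^{k\times k}$, $\omega_i\in\mathbb R^m$, $\rho_i\in\mathbb R^k$, $x\in\mathcal X$ satisfying: - $t\ge(\gamma_2\Sigma_0+\mu_0\mu_0^\top)\cdot Q+\mu_0^\top q+\sqrt{\gamma_1}\,\|\Sigma_0^{1/2}(q+2Q\mu_0)\|$, $Q\succeq0$, $\lambda\ge0$; - for $i=1,\dots,d$: $B_i^\top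 TW-(1-x_i)M\mathbf 1_{k\times k}\le\Gamma_i\le B_i^\top TW+(1-x_i)M\mathbf 1_{k\times k}$, $-x_iM\mathbf 1_{k\times k}\le\Gamma_i\le x_iM\mathbf 1_{k\times k}$; - for $i=1,\dots,d$: $\lambda-M(1-x_i)\le\theta_i\le Mx_i$, $0\le\theta_i\le\lambda$; - for $i=1,\dots,d$: $p_0-(1-x_i)M\mathbf 1_m\le\omega_i\le p_0+(1-x_i)M\mathbf 1_m$, $-x_iM\mathbf 1_m\le\omega_i\le x_iM\mathbf 1_m$; - for $i=1,\dots,d$: $(TW)^\top b_i-(1-x_i)M\mathbf 1_k\le\rho_i\le(TW)^\top b_i+(1-x_i)M\mathbf 1_k$, $-x_iM\mathbf 1_k\le\rho_i\le x_iM\mathbf 1_k$; - $AY+\Lambda W=\sum_{i=1}^d\theta_iB_i+\lambda B_0$, $\Lambda h-Ay_0+\sum_{i=1}^d\theta_ib_i+\lambda b_0\ge0$, $\Lambda\ge0$; - $A^\top TW+\lambda C=V$, $A^\top p_0+\lambda c_0=v_0$, $Th+p_0\ge0$, $T\ge0$. *)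

(* Defs.v *)
From HB Require Import structures.
From mathcomp Require Import all_boot all_order all_algebra.
From mathcomp Require Import all_classical all_reals all_analysis.
Set Implicit Arguments.
Unset Strict Implicit.
Unset Printing Implicit Defensive.
Import Order.TTheory GRing.Theory Num.Theory.
Import numFieldNormedType.Exports.
Local Open Scope classical_set_scope.
Local Open Scope ring_scope.

Section Matrices.
Context {R : realType}.

Definition mxle p q (X Y : 'M[R]_(p, q)) : Prop := forall i j, X i j <= Y i j.

Definition dotv p (u v : 'cV[R]_p) : R := (u^T *m v) 0 0.

Definition mxdot p q (X Y : 'M[R]_(p, q)) : R := \tr (X^T *m Y).

(* The library norm on matrices is the max norm. *)
Definition norm2 p (u : 'cV[R]_p) : R := Num.sqrt (\sum_i u i 0 ^+ 2).

Definition psdmx p (X : 'M[R]_p) : Prop :=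
  X^T = X /\ forall u : 'cV[R]_p, 0 <= (u^T *m X *m u) 0 0.

Definition pdmx p (X : 'M[R]_p) : Prop :=
  X^T = X /\ forall u : 'cV[R]_p, u != 0 -> 0 < (u^T *m X *m u) 0 0.

(* The principal square root, the only element of this set when X is positive
   semidefinite; the default value 0 is used only when the set is empty. *)
Definition sqrtmx p (X : 'M[R]_p) : 'M[R]_p :=
  xget 0 [set S : 'M[R]_p | psdmx S /\ S *m S = X].

End Matrices.

Notation "X <=e Y" := (mxle X Y) (at level 70, no associativity) : ring_scope.

(* R^k with its Borel sigma-algebra. *)
Definition borel (R : realType) (k : nat) :=
  g_sigma_algebraType (@open 'cV[R]_k).

Section Expectation.
Context {R : realType} {k : nat}.

(* Entrywise expectation. Entries whose expectation is infinite are sent to 0;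
   this does not occur for a continuous f and a law F carried by a compact
   set. *)
Definition mxexp p q (F : probability (borel R k) R)
    (f : 'cV[R]_k -> 'M[R]_(p, q)) : 'M[R]_(p, q) :=
  \matrix_(i, j) fine ('E_F[fun xi : borel R k => f xi i j])%E.

Definition square_integrable p (F : probability (borel R k) R)
    (f : 'cV[R]_k -> 'cV[R]_p) : Prop :=
  forall i, (fun xi : borel R k => f xi i 0) \in Lfun F 2%:E.

End Expectation.

Record ldr_data (R : realType) (d m n k l : nat) := LdrData {
  dX : set 'cV[R]_d;
  dw : 'cV[R]_d;
  dA : 'M[R]_(m, n);
  dC : 'M[R]_(n, k);
  dc0 : 'cV[R]_n;
  dV : 'M[R]_(n, k);
  dv0 : 'cV[R]_n;
  dB : 'I_d -> 'M[R]_(m, k);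
  dB0 : 'M[R]_(m, k);
  db : 'I_d -> 'cV[R]_m;
  db0 : 'cV[R]_m;
  dW : 'M[R]_(l, k);
  dh : 'cV[R]_l;
  dmu0 : 'cV[R]_k;
  dSigma0 : 'M[R]_k;
  dgamma1 : R;
  dgamma2 : R
}.

Record ldr_vars (R : realType) (d m n k : nat) := LdrVars {
  lx : 'cV[R]_d;
  llambda : R;
  lP : 'M[R]_(m, k);
  lp0 : 'cV[R]_m;
  lY : 'M[R]_(n, k);
  ly0 : 'cV[R]_n
}.

Record sdp_vars (R : realType) (d m n k l : nat) := SdpVars {
  sQ : 'M[R]_k;
  sq : 'cV[R]_k;
  sr : R;
  st : R;
  sY : 'M[R]_(n, k);
  sy0 : 'cV[R]_n;
  sp0 : 'cV[R]_m;
  slambda : R;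
  sT : 'M[R]_(m, l);
  sLambda : 'M[R]_(m, l);
  stheta : 'I_d -> R;
  sGamma : 'I_d -> 'M[R]_k;
  somega : 'I_d -> 'cV[R]_m;
  srho : 'I_d -> 'cV[R]_k;
  sx : 'cV[R]_d
}.

Section Programs.
Context {R : realType} {d m n k l : nat}.
Variable D : ldr_data R d m n k l.

Local Notation X := (dX D).
Local Notation w := (dw D).
Local Notation A := (dA D).
Local Notation C := (dC D).
Local Notation c0 := (dc0 D).
Local Notation V := (dV D).
Local Notation v0 := (dv0 D).
Local Notation B := (dB D).
Local Notation B0 := (dB0 D).
Local Notation b := (db D).
Local Notation b0 := (db0 D).
Local Notation W := (dW D).
Local Notation h := (dh D).
Local Notation mu0 := (dmu0 D).
Local Notation Sigma0 := (dSigma0 D).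
Local Notation gamma1 := (dgamma1 D).
Local Notation gamma2 := (dgamma2 D).

Definition cost (xi : 'cV[R]_k) : 'cV[R]_n := C *m xi + c0.
Definition valu (xi : 'cV[R]_k) : 'cV[R]_n := V *m xi + v0.
Definition rhs_mx (x : 'cV[R]_d) : 'M[R]_(m, k) :=
  \sum_(i < d) x i 0 *: B i + B0.
Definition rhs_cst (x : 'cV[R]_d) : 'cV[R]_m :=
  \sum_(i < d) x i 0 *: b i + b0.
Definition rhs (x : 'cV[R]_d) (xi : 'cV[R]_k) : 'cV[R]_m :=
  rhs_mx x *m xi + rhs_cst x.

Definition support_set : set 'cV[R]_k := [set xi | h <=e W *m xi].

Definition ambiguity : set (probability (borel R k) R) :=
  [set F : probability (borel R k) R | [/\ F support_set = 1%E,
    let delta := mxexp F id - mu0 in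
      (delta^T *m invmx Sigma0 *m delta) 0 0 <= gamma1
    & psdmx (gamma2 *: Sigma0
             - mxexp F (fun xi => (xi - mu0) *m (xi - mu0)^T))]].

Definition recourse_set (x : 'cV[R]_d) (xi : 'cV[R]_k) : set 'cV[R]_n :=
  [set y | A *m y <=e rhs x xi].

Definition ldr_feasible (z : ldr_vars R d m n k) : Prop :=
  let p xi := lP z *m xi + lp0 z in
  let y xi := lY z *m xi + ly0 z in
  [/\ X (lx z), 0 <= llambda z
    & forall xi, support_set xi ->
      [/\ A^T *m p xi + llambda z *: cost xi = valu xi,
          0 <=e p xi
        & A *m y xi <=e llambda z *: rhs (lx z) xi]].

Definition ldr_objective (z : ldr_vars R d m n k) : \bar R :=
  let p xi := lP z *m xi + lp0 z in
  let y xi := lY z *m xi + ly0 z in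
  ((dotv w (lx z))%:E
   + ereal_sup [set 'E_F[fun xi : borel R k =>
                  (dotv (rhs (lx z) xi) (p xi) + dotv (cost xi) (y xi))%R]
               | F in ambiguity])%E.

Definition ldr_value : \bar R :=
  ereal_inf [set ldr_objective z | z in [set z | ldr_feasible z]].

Record in_FM (M : R) (z : sdp_vars R d m n k l) : Prop := InFM {
  FM_t : mxdot (gamma2 *: Sigma0 + mu0 *m mu0^T) (sQ z) + dotv mu0 (sq z)
         + Num.sqrt gamma1
           * norm2 (sqrtmx Sigma0 *m (sq z + 2 *: (sQ z *m mu0)))
         <= st z;
  FM_Q : psdmx (sQ z);
  FM_lambda : 0 <= slambda z;
  FM_Gamma : forall i,
    [/\ (B i)^T *m sT z *m W - const_mx ((1 - sx z i 0) * M) <=e sGamma z i,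
        sGamma z i <=e (B i)^T *m sT z *m W + const_mx ((1 - sx z i 0) * M),
        - const_mx (sx z i 0 * M) <=e sGamma z i
      & sGamma z i <=e const_mx (sx z i 0 * M)];
  FM_theta : forall i,
    slambda z - M * (1 - sx z i 0) <= stheta z i <= M * sx z i 0
    /\ 0 <= stheta z i <= slambda z;
  FM_omega : forall i,
    [/\ sp0 z - const_mx ((1 - sx z i 0) * M) <=e somega z i,
        somega z i <=e sp0 z + const_mx ((1 - sx z i 0) * M),
        - const_mx (sx z i 0 * M) <=e somega z i
      & somega z i <=e const_mx (sx z i 0 * M)];
  FM_rho : forall i,
    [/\ (sT z *m W)^T *m b i - const_mx ((1 - sx z i 0) * M) <=e srho z i,
        srho z i <=e (sT z *m W)^T *m b i + const_mx ((1 - sx z i 0) * M),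
        - const_mx (sx z i 0 * M) <=e srho z i
      & srho z i <=e const_mx (sx z i 0 * M)];
  FM_primal_mx : A *m sY z + sLambda z *m W
                 = \sum_(i < d) stheta z i *: B i + slambda z *: B0;
  FM_primal_cst : 0 <=e sLambda z *m h - A *m sy0 z
                        + \sum_(i < d) stheta z i *: b i + slambda z *: b0;
  FM_Lambda : 0 <=e sLambda z;
  FM_dual_mx : A^T *m sT z *m W + slambda z *: C = V;
  FM_dual_cst : A^T *m sp0 z + slambda z *: c0 = v0;
  FM_dual_ge0 : 0 <=e sT z *m h + sp0 z;
  FM_T : 0 <=e sT z;
  FM_x : X (sx z)
}.

Definition sdp_N (z : sdp_vars R d m n k l) : 'M[R]_k :=
  \sum_(i < d) sGamma z i + B0^T *m sT z *m W + C^T *m sY z.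

Definition sdp_g (z : sdp_vars R d m n k l) (tau : 'cV[R]_l) : 'cV[R]_k :=
  2^-1 *: (sq z - \sum_(i < d) (B i)^T *m somega z i - B0^T *m sp0 z
           - \sum_(i < d) srho z i - (sT z *m W)^T *m b0 - C^T *m sy0 z
           - (sY z)^T *m c0 - W^T *m tau).

Definition sdp_corner (z : sdp_vars R d m n k l) (tau : 'cV[R]_l) : R :=
  sr z - \sum_(i < d) dotv (b i) (somega z i) - dotv b0 (sp0 z)
  - dotv c0 (sy0 z) + dotv tau h.

Definition sdp_block (z : sdp_vars R d m n k l) (tau : 'cV[R]_l) :
    'M[R]_(k + 1) :=
  block_mx (sQ z - 2^-1 *: (sdp_N z + (sdp_N z)^T)) (sdp_g z tau)
           (sdp_g z tau)^T (sdp_corner z tau)%:M.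

Definition sdp_feasible (M : R) (z : sdp_vars R d m n k l)
    (tau : 'cV[R]_l) : Prop :=
  [/\ in_FM M z, 0 <=e tau & psdmx (sdp_block z tau)].

Definition sdp_objective (z : sdp_vars R d m n k l) : R :=
  dotv w (sx z) + sr z + st z.

Definition sdp_value (M : R) : \bar R :=
  ereal_inf [set (sdp_objective z)%:E
            | z in [set z | exists tau, sdp_feasible M z tau]].

End Programs.

(* Main.v *)
(* Given a feasible point of the semidefinite program, the decision rule
   p(xi) = T W xi + p0, y(xi) = Y xi + y0 is feasible for (LDR): since x is
   binary, the big-M constraints force theta_i = x_i lambda,
   Gamma_i = x_i B_i^T T W, omega_i = x_i p0 and rho_i = x_i (T W)^T b_i, and
   the remaining constraints are Farkas certificates on W xi >= h.
   Evaluating the block matrix at (xi, 1) bounds the integrand on the support by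
   the quadratic function xi^T Q xi + q^T xi + r. Centring at mu0, its
   expectation is r + Q . E[(xi - mu0)(xi - mu0)^T] + q^T mu0 + mu0^T Q mu0
   + (q + 2 Q mu0)^T (E[xi] - mu0); the covariance constraint bounds the
   centred second-moment term by gamma2 Q . Sigma0 and, by Cauchy-Schwarz in the
   Sigma0-norm, the mean constraint bounds the last term by
   sqrt gamma1 * |Sigma0^(1/2) (q + 2 Q mu0)|, so the total is at most r + t. *)
Require Import Defs.
From HB Require Import structures.
From mathcomp Require Import all_boot all_order all_algebra.
From mathcomp Require Import all_classical all_reals all_analysis.
From mathcomp Require Import measurable_realfun complex.
From mathcomp Require Import ring lra.
Set Implicit Arguments.
Unset Strict Implicit.
Unset Printing Implicit Defensive.
Import Order.TTheory GRing.Theory Num.Theory.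
Import numFieldNormedType.Exports.
Local Open Scope classical_set_scope.
Local Open Scope ring_scope.

(** * Positive semidefinite matrices *)

(** By induction on the nodes: adding a multiple of the polynomial that vanishes at the earlier
    nodes corrects the value at a new node without disturbing the others. *)
Lemma poly_interpolation (F : fieldType) (f : F -> F) (s : seq F) :
  exists p : {poly F}, {in s, forall a, p.[a] = f a}.
Proof.
elim: s => [|a s [p pE]]; first by exists 0.
have [as_|aNs] := boolP (a \in s).
  by exists p => b; rewrite inE => /predU1P[->|]; exact: pE.
pose z := \prod_(b <- s) ('X - b%:P).
have za0 : z.[a] != 0 by rewrite -/(root z a) root_prod_XsubC.
exists (p + ((f a - p.[a]) / z.[a])%:P * z) => b.
rewrite inE hornerD hornerM hornerC => /predU1P[->|bs].
  by rewrite divfK// addrC subrK.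
have /eqP -> : root z b by rewrite root_prod_XsubC.
by rewrite mulr0 addr0 pE.
Qed.

Section Matrices.
Context {R : realType}.

Lemma dotvE p (u v : 'cV[R]_p) : dotv u v = \sum_i u i 0 * v i 0.
Proof. by rewrite /dotv mxE; apply: eq_bigr => i _; rewrite mxE. Qed.

Lemma dotvv_ge0 p (u : 'cV[R]_p) : 0 <= dotv u u.
Proof. by rewrite dotvE; apply: sumr_ge0 => i _; rewrite -expr2 sqr_ge0. Qed.

Lemma dotvv_eq0 p (u : 'cV[R]_p) : (dotv u u == 0) = (u == 0).
Proof.
rewrite dotvE; apply/idP/eqP => [|->]; last first.
  by rewrite big1// => i _; rewrite mxE mul0r.
rewrite psumr_eq0 => [/allP u0|i _]; last by rewrite -expr2 sqr_ge0.
apply/colP => i; rewrite mxE; apply/eqP.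
by have := u0 i (mem_index_enum _); rewrite implyTb mulf_eq0 orbb.
Qed.

Lemma psdmx_eigenvalue_ge0 p (S : 'M[R]_p) (a : R) :
  psdmx S -> eigenvalue S a -> 0 <= a.
Proof.
move=> [_ Spsd] /eigenvalueP[v vS v0].
have vv : 0 < dotv v^T v^T.
  by rewrite lt_def dotvv_ge0 dotvv_eq0 -trmx0 (inj_eq trmx_inj) v0.
have := Spsd v^T; rewrite trmxK vS -scalemxAl mxE.
by move: vv; rewrite /dotv trmxK => vv; rewrite pmulr_lge0.
Qed.

Lemma symmetric_horner_mx p (S : 'M[R]_p.+1) (q : {poly R}) :
  S^T = S -> (horner_mx S q)^T = horner_mx S q.
Proof.
move=> symS; elim/poly_ind: q => [|q c IH]; first by rewrite rmorph0 trmx0.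
rewrite rmorphD rmorphM /= horner_mx_X horner_mx_C linearD /= tr_scalar_mx.
congr (_ + _); rewrite -[LHS]/(( _ *m _)^T) trmx_mul IH symS.
by rewrite -[LHS]/(S * horner_mx S q); exact: comm_mx_horner.
Qed.

(* The eigenvalues of [S] over R[i] are real and nonnegative, so some real
   polynomial [q] maps each of them to its fourth root; then [q(S) ^ 2] is the
   root sought, and it is positive semidefinite because [q(S)] is symmetric. *)
Lemma psdmx_sqrt_exists p (S : 'M[R]_p) :
  psdmx S -> exists T : 'M[R]_p, psdmx T /\ T *m T = S.
Proof.
(* [symmetric_horner_mx] is for positive sizes; the only matrix of size 0 is its own root. *)
case: p S => [|p] S psdS.
  by exists S; split=> //; apply/matrixP => -[].
have [symS _] := psdS.
pose toC := real_complex R.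
pose SC := map_mx toC S.
have SCherm : SC \is hermsymmx.
  apply: realsym_hermsym.
    apply/is_hermitianmxP; rewrite expr0 scale1r map_mx_id //.
    by rewrite /SC matrix.map_trmx symS.
  by apply/mxOverP => i j; rewrite mxE /= complex_real.
have [P [e [Pu SCE ereal]]] : exists P : 'M[R[i]]_p.+1, exists e : 'rV_p.+1,
    [/\ P \in unitmx, SC = invmx P *m diag_mx e *m P & e \is a realmx].
  exists (spectralmx SC), (spectral_diag SC); split.
  - exact: spectral_unit.
  - exact: orthomx_spectralP (hermitian_normalmx SCherm).
  - exact: hermitian_spectral_diag_real.
pose r (i : 'I_p.+1) := complex.Re (e 0 i).
have eE i : e 0 i = toC (r i) by rewrite /toC /= RRe_real// (mxOverP ereal).
(* Row [i] of [P] is an eigenvector of [SC] for [r i]. Being a root of the characteristic polynomial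
   descends from R[i] to R, so [r i] is an eigenvalue of [S] itself. *)
have r_ge0 i : 0 <= r i.
  apply: (psdmx_eigenvalue_ge0 psdS).
  rewrite eigenvalue_root_char -(fmorph_root toC) map_char_poly -/SC /=.
  rewrite -[(r i)%:C%C]/(toC (r i)) -eE.
  rewrite -eigenvalue_root_char; apply/eigenvalueP; exists (row i P).
    rewrite SCE -row_mul !mulmxA mulmxV // mul1mx.
    by rewrite row_mul row_diag_mx -scalemxAl -rowE.
  apply/eqP => Pi0; have := congr1 (row i) (mulmxV Pu).
  rewrite row_mul Pi0 mul0mx => /rowP/(_ i)/eqP.
  by rewrite !mxE eqxx eq_sym oner_eq0.
have [q qE] := poly_interpolation (fun a => Num.sqrt (Num.sqrt a)) (codom r).
pose H := horner_mx S q.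
have Hsym : H^T = H by exact: symmetric_horner_mx.
exists (H *m H); split.
  split; first by rewrite trmx_mul Hsym.
  move=> u; have -> : u^T *m (H *m H) *m u = (H *m u)^T *m (H *m u).
    by rewrite trmx_mul Hsym !mulmxA.
  exact: dotvv_ge0.
have -> : H *m H *m (H *m H) = horner_mx S (q ^+ 4).
  by rewrite rmorphXn /= -[LHS]/(H * H * (H * H)) -!expr2 -exprM.
apply: (map_mx_inj (f := toC)).
rewrite map_horner_mx -/SC SCE horner_mx_uconjC // horner_mx_diag.
congr (_ *m _ *m _); congr diag_mx; apply/rowP => i; rewrite !mxE eE.
rewrite horner_map horner_exp qE ?codom_f //.
by rewrite -[4%N]/(2 * 2)%N exprM !sqr_sqrtr ?sqrtr_ge0.
Qed.

Lemma sqrtmxP p (S : 'M[R]_p) :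
  psdmx S -> psdmx (sqrtmx S) /\ sqrtmx S *m sqrtmx S = S.
Proof.
move=> /psdmx_sqrt_exists[T TP].
exact: (@xgetI _ 0 [set T : 'M[R]_p | psdmx T /\ T *m T = S] _ TP).
Qed.

Lemma pdmx_psd p (S : 'M[R]_p) : pdmx S -> psdmx S.
Proof.
move=> [symS Sp]; split=> // u; have [->|/Sp/ltW //] := eqVneq u 0.
by rewrite mulmx0 mxE.
Qed.

Lemma pdmx_unit p (S : 'M[R]_p) : pdmx S -> S \in unitmx.
Proof.
move=> [symS Sp]; rewrite -row_free_unit -kermx_eq0; apply/eqP/row_matrixP => i.
rewrite row0; apply/eqP/negP => /negP vS0.
have : 0 < ((row i (kermx S))^T^T *m S *m (row i (kermx S))^T) 0 0.
  by apply: Sp; rewrite -trmx0 (inj_eq trmx_inj).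
by rewrite trmxK -row_mul mulmx_ker row0 mul0mx mxE ltxx.
Qed.

(** With S the square root of Q, the trace of Q Z is that of S Z S, whose diagonal entries are the
    values of the form of Z at the columns of S. *)
Lemma psdmx_mxdot_ge0 p (Q Z : 'M[R]_p) : psdmx Q -> psdmx Z -> 0 <= mxdot Q Z.
Proof.
move=> /sqrtmxP[[symS _] SSQ] [_ Zpsd].
set S := sqrtmx Q in symS SSQ.
rewrite /mxdot -SSQ trmx_mul symS -mulmxA mxtrace_mulC.
apply: sumr_ge0 => i _.
have := Zpsd (col i S).
by rewrite tr_col symS colE -!row_mul mulmxA -colE !mxE.
Qed.

Lemma norm2E p (u : 'cV[R]_p) : norm2 u = Num.sqrt (dotv u u).
Proof. by rewrite dotvE. Qed.

Lemma dotv_le_norm2 p (u v : 'cV[R]_p) : dotv u v <= norm2 u * norm2 v.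
Proof.
have n2 (x : 'cV[R]_p) : norm2 x ^+ 2 = dotv x x.
  by rewrite norm2E sqr_sqrtr ?dotvv_ge0.
have n0 (x : 'cV[R]_p) : norm2 x = 0 -> x = 0.
  by move=> x0; apply/eqP; rewrite -dotvv_eq0 -n2 x0 expr0n.
have [/n0 -> |u0] := eqVneq (norm2 u) 0.
  by rewrite dotvE big1 ?mulr_ge0 ?sqrtr_ge0// => i _; rewrite mxE mul0r.
have [/n0 -> |v0] := eqVneq (norm2 v) 0.
  by rewrite dotvE big1 ?mulr_ge0 ?sqrtr_ge0// => i _; rewrite mxE mulr0.
have ab : 0 < norm2 u * norm2 v by rewrite mulr_gt0 // lt_def ?u0 ?v0 sqrtr_ge0.
(* This square expands to 2 ab (ab - u.v) with a, b the two norms; dividing by ab > 0 gives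
   Cauchy-Schwarz. *)
have := dotvv_ge0 (norm2 v *: u - norm2 u *: v).
have -> : dotv (norm2 v *: u - norm2 u *: v) (norm2 v *: u - norm2 u *: v) =
    norm2 v ^+ 2 * dotv u u + norm2 u ^+ 2 * dotv v v
    - 2 * (norm2 u * norm2 v) * dotv u v.
  rewrite !dotvE !mulr_sumr -big_split -sumrB; apply: eq_bigr => i _ /=.
  by rewrite !mxE; ring.
rewrite -!n2 => H; rewrite -(ler_pM2l ab); nra.
Qed.

End Matrices.

(** * Bilinear identities for the two inner products *)

Section Bilinear.
Context {R : realType}.

Lemma mxdotE p q (X Y : 'M[R]_(p, q)) :
  mxdot X Y = \sum_ij X ij.1 ij.2 * Y ij.1 ij.2.
Proof.
rewrite /mxdot /mxtrace -(pair_bigA _ (fun i j => X i j * Y i j)) exchange_big.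
by apply: eq_bigr => j _; rewrite mxE; apply: eq_bigr => i _; rewrite mxE.
Qed.

Lemma mxdotC p q (X Y : 'M[R]_(p, q)) : mxdot X Y = mxdot Y X.
Proof. by rewrite !mxdotE; apply: eq_bigr => ij _; rewrite mulrC. Qed.

Lemma mxdotDr p q (X Y Z : 'M[R]_(p, q)) :
  mxdot X (Y + Z) = mxdot X Y + mxdot X Z.
Proof. by rewrite /mxdot mulmxDr mxtraceD. Qed.

Lemma mxdotZr p q a (X Y : 'M[R]_(p, q)) : mxdot X (a *: Y) = a * mxdot X Y.
Proof. by rewrite /mxdot -scalemxAr mxtraceZ. Qed.

Lemma mxdotNr p q (X Y : 'M[R]_(p, q)) : mxdot X (- Y) = - mxdot X Y.
Proof. by rewrite -scaleN1r mxdotZr mulN1r. Qed.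

Lemma dotv_mxdot p (u v : 'cV[R]_p) : dotv u v = mxdot u v.
Proof. by rewrite /mxdot /mxtrace big_ord1. Qed.

Lemma dotvC p (u v : 'cV[R]_p) : dotv u v = dotv v u.
Proof. by rewrite !dotv_mxdot mxdotC. Qed.

Lemma dotvDr p (u v w : 'cV[R]_p) : dotv u (v + w) = dotv u v + dotv u w.
Proof. by rewrite !dotv_mxdot mxdotDr. Qed.

Lemma dotvZr p a (u v : 'cV[R]_p) : dotv u (a *: v) = a * dotv u v.
Proof. by rewrite !dotv_mxdot mxdotZr. Qed.

Lemma dotvNr p (u v : 'cV[R]_p) : dotv u (- v) = - dotv u v.
Proof. by rewrite !dotv_mxdot mxdotNr. Qed.

Lemma dotvDl p (u v w : 'cV[R]_p) : dotv (v + w) u = dotv v u + dotv w u.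
Proof. by rewrite dotvC dotvDr !(dotvC u). Qed.

Lemma dotvZl p a (u v : 'cV[R]_p) : dotv (a *: v) u = a * dotv v u.
Proof. by rewrite dotvC dotvZr dotvC. Qed.

Lemma dotvNl p (u v : 'cV[R]_p) : dotv (- v) u = - dotv v u.
Proof. by rewrite dotvC dotvNr dotvC. Qed.

Lemma dotv_mulmxl p q (G : 'M[R]_(p, q)) u v :
  dotv (G *m u) v = dotv u (G^T *m v).
Proof. by rewrite /dotv trmx_mul mulmxA. Qed.

Lemma dotv_mulmxr p q (G : 'M[R]_(p, q)) u v :
  dotv u (G *m v) = dotv (G^T *m u) v.
Proof. by rewrite dotv_mulmxl trmxK. Qed.

Lemma dotv_le p (u v w : 'cV[R]_p) : 0 <=e u -> v <=e w -> dotv u v <= dotv u w.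
Proof.
move=> u0 vw; rewrite !dotvE; apply: ler_sum => i _.
by apply: ler_wpM2l (vw i 0); have := u0 i 0; rewrite mxE.
Qed.

Lemma mxdot_outer p (X : 'M[R]_p) (u : 'cV[R]_p) :
  mxdot X (u *m u^T) = dotv u (X *m u).
Proof.
by rewrite dotv_mulmxr dotvC /mxdot mulmxA mxtrace_mulC /mxtrace big_ord1.
Qed.

(** Splits a product of affine maps into the quadratic, linear and constant parts that the block
    matrix has to dominate. *)
Lemma dotv_affine p q (G H : 'M[R]_(p, q)) (g h : 'cV[R]_p) (u : 'cV[R]_q) :
  dotv (G *m u + g) (H *m u + h) =
  dotv u ((G^T *m H) *m u) + dotv (G^T *m h + H^T *m g) u + dotv g h.
Proof.
rewrite !dotvDl !dotvDr !(dotv_mulmxl G) (dotvC u (G^T *m h)) (dotv_mulmxr H g).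
by rewrite mulmxA; ring.
Qed.

Lemma psdmx_block_quadratic p (X : 'M[R]_p) (g : 'cV[R]_p) (c : R) :
  psdmx (block_mx X g g^T c%:M) ->
  forall u : 'cV[R]_p, 0 <= dotv u (X *m u) + 2 * dotv g u + c.
Proof.
move=> [_ /[swap] u /(_ (col_mx u 1%:M))].
rewrite -mulmxA mul_block_col tr_col_mx mul_row_col !mulmx1 !mulmxDr.
rewrite trmx1 !mul1mx.
rewrite mulr_natl mulr2n {1}(dotvC g) /dotv !mxE.
by rewrite mulr1n !addrA.
Qed.

End Bilinear.

(** * Expectations under a law carried by a compact set *)

Section EntrywiseContinuity.
Context {R : realType} {T : topologicalType}.

Lemma continuous_addr (f g : T -> R) :
  continuous f -> continuous g -> continuous (fun t => f t + g t).
Proof. by move=> cf cg t; exact: (continuousD (cf t) (cg t)). Qed.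

(** Continuity is asked of each scalar entry, since products, transposes and [mxexp] are all
    computed entrywise. *)
Definition entries_continuous p q (f : T -> 'M[R]_(p, q)) :=
  forall i j, continuous (fun t => f t i j).

Lemma entries_continuous_cst p q (X : 'M[R]_(p, q)) :
  entries_continuous (cst X).
Proof. by move=> i j; exact: cst_continuous. Qed.

Lemma entries_continuousD p q (f g : T -> 'M[R]_(p, q)) :
  entries_continuous f -> entries_continuous g ->
  entries_continuous (fun t => f t + g t).
Proof.
move=> cf cg i j t; under eq_fun do rewrite mxE.
exact: (continuousD (cf i j t) (cg i j t)).
Qed.

Lemma entries_continuous_tr p q (f : T -> 'M[R]_(p, q)) :
  entries_continuous f -> entries_continuous (fun t => (f t)^T).
Proof. by move=> cf i j; under eq_fun do rewrite mxE; exact: cf. Qed.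

Lemma continuous_sumr (I : Type) (s : seq I) (P : pred I) (f : I -> T -> R) :
  (forall i, P i -> continuous (f i)) ->
  continuous (fun t => \sum_(i <- s | P i) f i t).
Proof. by apply: continuous_big; exact: add_continuous. Qed.

Lemma entries_continuousM p q r (f : T -> 'M[R]_(p, q))
    (g : T -> 'M[R]_(q, r)) :
  entries_continuous f -> entries_continuous g ->
  entries_continuous (fun t => f t *m g t).
Proof.
move=> cf cg i j; under eq_fun do rewrite mxE.
by apply: continuous_sumr => l _ t; exact: (continuousM (cf i l t) (cg l j t)).
Qed.

Lemma continuous_dotv p (f g : T -> 'cV[R]_p) :
  entries_continuous f -> entries_continuous g ->
  continuous (fun t => dotv (f t) (g t)).
Proof.
move=> cf cg.
exact: (entries_continuousM (entries_continuous_tr cf) cg).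
Qed.

Lemma continuous_mxdot p q (f g : T -> 'M[R]_(p, q)) :
  entries_continuous f -> entries_continuous g ->
  continuous (fun t => mxdot (f t) (g t)).
Proof.
move=> cf cg; apply: continuous_sumr => i _.
exact: (entries_continuousM (entries_continuous_tr cf) cg).
Qed.

End EntrywiseContinuity.

Lemma entries_continuous_affine (R : realType) p q (G : 'M[R]_(p, q)) g :
  entries_continuous (fun u : 'cV[R]_q => G *m u + g).
Proof.
apply: entries_continuousD; last exact: entries_continuous_cst.
apply: entries_continuousM; first exact: entries_continuous_cst.
by move=> i j; exact: coord_continuous.
Qed.

Lemma Rintegral_sum d (T : measurableType d) (R : realType)
    (mu : {measure set T -> \bar R}) (D : set T) (I : Type) (s : seq I)
    (P : pred I) (f : I -> T -> R) :
  measurable D -> (forall i, mu.-integrable D (EFin \o f i)) ->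
  \int[mu]_(x in D) (\sum_(i <- s | P i) f i x) =
  \sum_(i <- s | P i) \int[mu]_(x in D) f i x.
Proof.
move=> mD fI; rewrite /Rintegral sum_fine => [|i _]; last first.
  by apply: integrable_fin_num => //; exact: fI.
rewrite -integral_sum//; congr fine; apply: eq_integral => x _.
by rewrite sumEFin.
Qed.

(** * Integration of continuous functions against a law carried by a compact set *)

Section Carried.
Context {R : realType} {k : nat}.
Implicit Types (F : probability (borel R k) R) (f g : 'cV[R]_k -> R).

Lemma borel_continuous_measurable f :
  continuous f -> measurable_fun setT (f : borel R k -> R).
Proof.
move=> /continuousP cf; apply: (measurability _ (RGenOpens.measurableE R)).
move=> _ [_ [a [b ->] <-]]; rewrite setTI.
apply: sub_sigma_algebra; exact/cf/interval_open.
Qed.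

Lemma borel_compact_measurable (S : set 'cV[R]_k) :
  compact S -> measurable (S : set (borel R k)).
Proof.
move=> /(compact_closed (@norm_hausdorff _ _))/closed_openC oS.
rewrite -[S]setCK; apply: measurableC; exact: sub_sigma_algebra.
Qed.

Variables (F : probability (borel R k) R) (S : set 'cV[R]_k).
Hypotheses (S_compact : compact S) (FS : F S = 1%E).

Let mS : measurable (S : set (borel R k)) := borel_compact_measurable S_compact.

Let FNS : F (~` S) = 0%E.
Proof. by rewrite probability_setC// FS subee. Qed.

(** The complement of [S] is null, and on the compact set [S] the continuous f is bounded. *)
Lemma carried_integrable f : continuous f -> F.-integrable setT (EFin \o f).
Proof.
move=> cf; have mf := borel_continuous_measurable cf.
apply/(negligible_integrable (measurableC mS) measurableT _ FNS).
  exact/measurable_EFinP.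
rewrite setTD setCK; apply: measurable_bounded_integrable => //.
- by apply: (le_lt_trans (probability_le1 F mS)); rewrite ltry.
- exact: measurable_funS mf.
- have /compact_bounded :=
    continuous_compact (continuous_subspaceT cf) S_compact.
  move=> [N [Nr bN]]; exists N; split=> // x Nx y Sy; apply: bN Nx _ _.
  by exists y.
Qed.

(** Both integrals reduce to [S], so the comparison of f and g is only asked there. *)
Lemma carried_le_Rintegral f g : continuous f -> continuous g ->
  (forall x, S x -> f x <= g x) -> \int[F]_x f x <= \int[F]_x g x.
Proof.
move=> cf cg fg.
have If := carried_integrable cf; have Ig := carried_integrable cg.
have IS h : F.-integrable setT (EFin \o h) ->
    \int[F]_x h x = \int[F]_(x in S) h x.
  move=> Ih; rewrite /Rintegral (negligible_integral (measurableC mS) _ Ih)//.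
  by rewrite setTD setCK.
rewrite !IS//.
apply: le_Rintegral => //.
- exact: integrableS If.
- exact: integrableS Ig.
Qed.

Lemma expectation_fineK f : continuous f -> 'E_F[f]%E = (\int[F]_x f x)%:E.
Proof.
move=> cf; rewrite unlock fineK//.
exact/integrable_fin_num/carried_integrable.
Qed.

Lemma Rintegral_mxdot p q (Q : 'M[R]_(p, q)) (f : 'cV[R]_k -> 'M[R]_(p, q)) :
  entries_continuous f ->
  \int[F]_xi mxdot Q (f xi) = mxdot Q (mxexp F f).
Proof.
move=> cf.
have If i j : F.-integrable setT (EFin \o (fun xi => Q i j * f xi i j)).
  apply: carried_integrable => x.
  apply: (@continuousM _ _ (cst (Q i j)) (fun xi => f xi i j)); last exact: cf.
  exact: cst_continuous.
under eq_Rintegral do rewrite mxdotE.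
rewrite Rintegral_sum//; rewrite mxdotE; apply: eq_bigr => -[i j] _ /=.
rewrite RintegralZl//; last exact: carried_integrable.
by rewrite mxE unlock.
Qed.

End Carried.

(** * The decision rule of a feasible point *)

(** At x = 1 the first pair of inequalities closes to g = a; at x = 0 the second pair closes to g =
    0. In each case the factor of M in the deciding pair is zero. *)
Lemma bigM_active (R : realDomainType) (M g a x : R) : x = 0 \/ x = 1 ->
  a - (1 - x) * M <= g -> g <= a + (1 - x) * M ->
  - (x * M) <= g -> g <= x * M -> g = x * a.
Proof.
move=> [] ->; rewrite !(subr0, subrr, mul0r, mul1r, oppr0, addr0) => *.
  by apply/le_anti/andP; lra.
by apply/le_anti/andP; lra.
Qed.

Lemma bigM_active_mx (R : realType) p q (M x : R) (G X : 'M[R]_(p, q)) :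
  x = 0 \/ x = 1 ->
  [/\ X - const_mx ((1 - x) * M) <=e G, G <=e X + const_mx ((1 - x) * M),
      - const_mx (x * M) <=e G & G <=e const_mx (x * M)] ->
  G = x *: X.
Proof.
move=> xb [G1 G2 G3 G4]; apply/matrixP => i j; rewrite mxE.
move: (G1 i j) (G2 i j) (G3 i j) (G4 i j); rewrite !mxE.
exact: bigM_active.
Qed.

Section Approximation.
Context {R : realType} {d m n k l : nat} (D : ldr_data R d m n k l).

(** Weak duality for the moment constraints: the bound is r plus the quantity that [FM_t] places
    below t. *)
Lemma ambiguity_quadratic_le (F : probability (borel R k) R)
    (Q : 'M[R]_k) (q : 'cV[R]_k) (r : R) :
  compact (support_set D) -> pdmx (dSigma0 D) -> 0 <= dgamma1 D ->
  ambiguity D F -> psdmx Q ->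
  \int[F]_xi (dotv xi (Q *m xi) + dotv q xi + r) <=
  r + mxdot (dgamma2 D *: dSigma0 D + dmu0 D *m (dmu0 D)^T) Q
    + dotv (dmu0 D) q
    + Num.sqrt (dgamma1 D)
      * norm2 (sqrtmx (dSigma0 D) *m (q + 2 *: (Q *m dmu0 D))).
Proof.
move=> cS Spd g1 [FS /= mean cov] Qpsd.
set mu := dmu0 D in mean cov *; set S := dSigma0 D in Spd mean cov *.
set u := q + 2 *: (Q *m mu); set delta := mxexp F id - mu in mean.
have symQ : Q^T = Q by case: Qpsd.
pose second (xi : 'cV[R]_k) : 'M[R]_k := (xi - mu) *m (xi - mu)^T.
have c_id : entries_continuous (fun xi : 'cV[R]_k => xi).
  by move=> i j; exact: coord_continuous.
have c_sub : entries_continuous (fun xi : 'cV[R]_k => xi - mu).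
  by apply: entries_continuousD => //; exact: entries_continuous_cst.
have c_second : entries_continuous second.
  by apply: entries_continuousM => //; exact: entries_continuous_tr.
(* Once centred at [mu], the quadratic is affine in [second xi] and [xi], so its expectation only
   involves the two moments that the ambiguity set controls. *)
have quadE xi : dotv xi (Q *m xi) + dotv q xi + r =
    mxdot Q (second xi) + mxdot u xi + (r - dotv mu (Q *m mu)).
  have QC v : dotv mu (Q *m v) = dotv v (Q *m mu).
    by rewrite dotv_mulmxr symQ dotvC.
  rewrite mxdot_outer -dotv_mxdot mulmxBr !dotvDl !dotvDr dotvZl.
  rewrite !dotvNr !dotvNl.
  by rewrite (QC xi) (dotvC (Q *m mu)); ring.
have Imx p' q' (X : 'M[R]_(p', q')) f : entries_continuous f ->
    F.-integrable setT (EFin \o (fun xi => mxdot X (f xi))).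
  move=> cf; apply: (carried_integrable cS FS).
  by apply: continuous_mxdot => //; exact: entries_continuous_cst.
have -> : \int[F]_xi (dotv xi (Q *m xi) + dotv q xi + r) =
    mxdot Q (mxexp F second) + mxdot u (mxexp F id) + (r - dotv mu (Q *m mu)).
  under eq_Rintegral do rewrite quadE.
  rewrite RintegralD//; last 2 first.
  - exact: integrableD (Imx _ _ _ _ c_second) (Imx _ _ _ _ c_id).
  - exact: finite_measure_integrable_cst.
  rewrite RintegralD//; [|exact: Imx..].
  have Icst c : \int[F]_xi c = c.
    by rewrite -[RHS]/(fine c%:E) -(expectation_cst F c) unlock.
  by rewrite !(Rintegral_mxdot cS FS)// Icst.
(* The positive semidefinite gap in the covariance constraint pairs nonnegatively with [Q]. *)
have covQ : mxdot Q (mxexp F second) <= dgamma2 D * mxdot Q S.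
  have := psdmx_mxdot_ge0 Qpsd cov.
  by rewrite mxdotDr mxdotNr mxdotZr subr_ge0.
have meanQ : dotv u delta <= Num.sqrt (dgamma1 D) * norm2 (sqrtmx S *m u).
  have Su := pdmx_unit Spd.
  have [[symH _] HH] := sqrtmxP (pdmx_psd Spd).
  set H := sqrtmx S in symH HH *.
  (* Here [delta] is written as H H S^-1 delta. After Cauchy-Schwarz, the squared norm of H S^-1
     delta is delta^T S^-1 delta, which the mean constraint bounds by gamma1. *)
  have -> : dotv u delta = dotv (H *m u) (H *m (invmx S *m delta)).
    by rewrite dotv_mulmxr mulmxA symH HH dotv_mulmxl (proj1 Spd) mulKVmx.
  rewrite mulrC; apply: le_trans (dotv_le_norm2 _ _) _.
  rewrite ler_wpM2l ?sqrtr_ge0 // norm2E ler_sqrt //.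
  rewrite dotv_mulmxr mulmxA symH HH mulKVmx //.
  by rewrite /dotv mulmxA.
have -> : mxdot u (mxexp F id) =
    dotv u delta + dotv q mu + 2 * dotv mu (Q *m mu).
  rewrite -[RHS]addrA; have <- : dotv u mu = dotv q mu + 2 * dotv mu (Q *m mu).
    by rewrite dotvDl dotvZl (dotvC (Q *m mu)).
  by rewrite -dotv_mxdot dotvDr dotvNr; ring.
rewrite [mxdot _ Q]mxdotC mxdotDr mxdotZr mxdot_outer (dotvC mu q).
lra.
Qed.


Definition ldr_of_sdp (z : sdp_vars R d m n k l) : ldr_vars R d m n k :=
  LdrVars (sx z) (slambda z) (sT z *m dW D) (sp0 z) (sY z) (sy0 z).

Variables (M : R) (z : sdp_vars R d m n k l).
Hypothesis X_binary : forall x, dX D x -> forall i, x i 0 = 0 \/ x i 0 = 1.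
Hypothesis zFM : in_FM D M z.

Let x_binary i : sx z i 0 = 0 \/ sx z i 0 = 1 := X_binary (FM_x zFM) i.

Let x := sx z.
Let P := sT z *m dW D.

Let GammaE i : sGamma z i = x i 0 *: ((dB D i)^T *m P).
Proof. by rewrite mulmxA; exact: bigM_active_mx (FM_Gamma zFM i). Qed.

Let omegaE i : somega z i = x i 0 *: sp0 z.
Proof. exact: bigM_active_mx (FM_omega zFM i). Qed.

Let rhoE i : srho z i = x i 0 *: (P^T *m db D i).
Proof. exact: bigM_active_mx (FM_rho zFM i). Qed.

(** The bounds on theta are paired crosswise: at x_i = 0 the bounds M x_i and 0 meet, at x_i = 1 the
    bounds lambda - M (1 - x_i) and lambda meet. *)
Let thetaE i : stheta z i = slambda z * x i 0.
Proof.
have [/andP[t1 t2] /andP[t3 t4]] := FM_theta zFM i; move: t1 t2.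
rewrite /x; case: (x_binary i) => ->;
  rewrite ?(subr0, subrr, mulr0, mulr1) => t1 t2; exact/le_anti/andP.
Qed.

(** On the support, p = T (W xi - h) + (T h + p0), and lambda b_x - A y is Lambda (W xi - h) plus
    the vector of [FM_primal_cst]; all these terms are nonnegative. The equality constraint holds
    coefficient by coefficient. *)
Lemma ldr_of_sdp_feasible : ldr_feasible D (ldr_of_sdp z).
Proof.
split; [exact: FM_x zFM|exact: FM_lambda zFM|move=> xi hxi].
have Wxi : 0 <=e dW D *m xi - dh D.
  by move=> i j; rewrite !mxE subr_ge0 ord1; have := hxi i 0; rewrite mxE.
have mul_ge0 p (G : 'M[R]_(p, l)) : 0 <=e G -> 0 <=e G *m (dW D *m xi - dh D).
  move=> G0 i j; rewrite [leRHS]mxE [leLHS]mxE; apply: sumr_ge0 => a _.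
  by apply: mulr_ge0; [have := G0 i a|have := Wxi a j]; rewrite mxE.
split => /=.
- rewrite /cost /valu mulmxDr scalerDr addrACA (FM_dual_cst zFM).
  by rewrite !mulmxA scalemxAl -mulmxDl (FM_dual_mx zFM).
- move=> i j; have := mul_ge0 _ _ (FM_T zFM) i j; have := FM_dual_ge0 zFM i j.
  by rewrite mulmxBr !mulmxA !mxE; lra.
(* The products lambda x_i in the right-hand side are exactly the theta_i, which brings in the
   coefficients of [FM_primal_mx]. *)
- have lamE : slambda z *: rhs D x xi =
      (dA D *m sY z + sLambda z *m dW D) *m xi
      + (\sum_(i < d) stheta z i *: db D i + slambda z *: db0 D).
    rewrite (FM_primal_mx zFM) /rhs /rhs_mx /rhs_cst scalerDr scalemxAl.
    rewrite !scalerDr !scaler_sumr.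
    congr ((_ + _) *m _ + (_ + _)); apply: eq_bigr => i _.
      by rewrite scalerA thetaE.
    by rewrite scalerA thetaE.
  move=> i j; rewrite lamE.
  have := mul_ge0 _ _ (FM_Lambda zFM) i j; have := FM_primal_cst zFM i j.
  rewrite mulmxBr mulmxDr mulmxDl !mulmxA -!addrA.
  move: (\sum_i _) (_ *: db0 D) => s1 s2; rewrite !mxE; lra.
Qed.

(** This and the next two identities undo the linearisation: they express the blocks through the
    coefficients that [dotv_affine] gives for the integrand. *)
Lemma sdp_NE : sdp_N D z = (rhs_mx D x)^T *m P + (dC D)^T *m sY z.
Proof.
rewrite /sdp_N /rhs_mx [(_ + _)^T]linearD /= [(\sum_i _)^T]linear_sum /=.
rewrite mulmxDl mulmx_suml -!mulmxA /=.
congr (_ + _ + _); apply: eq_bigr => i _.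
by rewrite GammaE [(_ *: _)^T]linearZ /= -scalemxAl.
Qed.

Lemma sdp_gE tau : 2 *: sdp_g D z tau =
  sq z - ((rhs_mx D x)^T *m sp0 z + P^T *m rhs_cst D x)
  - ((dC D)^T *m sy0 z + (sY z)^T *m dc0 D) - (dW D)^T *m tau.
Proof.
rewrite /sdp_g scalerA divff ?pnatr_eq0// scale1r /rhs_mx /rhs_cst.
rewrite [(_ + _)^T]linearD /= [(\sum_i _)^T]linear_sum /= mulmxDl mulmx_suml.
rewrite mulmxDr mulmx_sumr /=.
have -> : \sum_i (dB D i)^T *m somega z i = \sum_i (x i 0 *: dB D i)^T *m sp0 z.
  apply: eq_bigr => i _.
  by rewrite omegaE [(_ *: _)^T]linearZ /= -scalemxAl -scalemxAr.
have -> : \sum_i srho z i = \sum_i P^T *m (x i 0 *: db D i).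
  by apply: eq_bigr => i _; rewrite rhoE -scalemxAr.
(* The matrix products become opaque vectors, leaving an additive identity between entries. *)
rewrite -/P; move: (\sum_i (x i 0 *: dB D i)^T *m sp0 z).
move: (\sum_i P^T *m (x i 0 *: db D i)).
move: (sq z) (_ *m sp0 z) (P^T *m _).
move: (_ *m sy0 z) (_ *m dc0 D) (_ *m tau) => a1 a2 a3 a4 a5 a6 a7 a8.
by apply/colP => i; rewrite !mxE; ring.
Qed.

Lemma sdp_cornerE tau : sdp_corner D z tau =
  sr z - dotv (rhs_cst D x) (sp0 z) - dotv (dc0 D) (sy0 z) + dotv tau (dh D).
Proof.
have -> : dotv (rhs_cst D x) (sp0 z) =
    \sum_i dotv (db D i) (somega z i) + dotv (db0 D) (sp0 z).
  rewrite dotvDl dotv_mxdot mxdotC /mxdot mulmx_sumr raddf_sum /=.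
  congr (_ + _); apply: eq_bigr => i _.
  by rewrite omegaE -/(mxdot _ _) mxdotC -dotv_mxdot dotvZl dotvZr.
by rewrite /sdp_corner; ring.
Qed.

(** The block form at (xi, 1) equals the quadratic minus the integrand minus tau.(W xi - h). The
    last product is nonnegative on the support, so tau acts as a multiplier for W xi >= h. *)
Lemma sdp_integrand_le tau xi : 0 <=e tau -> psdmx (sdp_block D z tau) ->
  support_set D xi ->
  dotv (rhs D x xi) (P *m xi + sp0 z) + dotv (cost D xi) (sY z *m xi + sy0 z)
  <= dotv xi (sQ z *m xi) + dotv (sq z) xi + sr z.
Proof.
move=> tau0 /psdmx_block_quadratic/(_ xi) blk hxi.
have slack := dotv_le tau0 hxi.
(* Symmetrising N leaves its quadratic form unchanged. *)
have quad_tr (N : 'M[R]_k) : dotv xi (N^T *m xi) = dotv xi (N *m xi).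
  by rewrite dotv_mulmxr trmxK dotvC.
rewrite /rhs /cost !dotv_affine -/x.
move: blk; rewrite -dotvZl sdp_gE sdp_cornerE sdp_NE.
move: slack; rewrite (dotv_mulmxr (dW D)).
move: (rhs_mx D x) (rhs_cst D x) => G g.
rewrite mulmxBl -scalemxAl mulmxDl.
rewrite !(dotvDl, dotvDr, dotvNr, dotvNl, dotvZr) quad_tr mulmxDl dotvDr.
lra.
Qed.

End Approximation.

Theorem theorem2 (R : realType) (d m n k l : nat) (D : ldr_data R d m n k l)
    (M : R)
    (X_binary : forall x, dX D x -> forall i, x i 0 = 0 \/ x i 0 = 1)
    (support_compact : compact (support_set D))
    (Sigma0_pd : pdmx (dSigma0 D))
    (gamma1_ge0 : 0 <= dgamma1 D)
    (gamma2_ge1 : 1 <= dgamma2 D)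
    (cost_sq : forall F, ambiguity D F -> square_integrable F (cost D))
    (valu_sq : forall F, ambiguity D F -> square_integrable F (valu D))
    (rhs_sq : forall x F, dX D x -> ambiguity D F ->
      square_integrable F (rhs D x))
    (recourse : forall x F, dX D x -> ambiguity D F ->
      {ae F, forall xi : borel R k,
        recourse_set D x xi !=set0 /\ bounded_set (recourse_set D x xi)})
    (M_gt0 : 0 < M) :
  (ldr_value D <= sdp_value D M)%E.
Proof.
(* Each feasible point of the semidefinite program yields a feasible decision rule of no larger
   cost, which compares the infima. *)
apply: le_ereal_inf_tmp => _ [z [tau [zFM tau0 blk]] <-].
apply: ge_ereal_inf; exists (ldr_objective D (ldr_of_sdp D z)).
  by exists (ldr_of_sdp D z) => //; exact: ldr_of_sdp_feasible X_binary zFM.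
(* The term w^T x is common to both sides; what remains is to bound each expectation by r + t. *)
rewrite /ldr_objective /sdp_objective -addrA EFinD leeD2l//.
apply: ge_ereal_sup => _ [F FD <-] /=.
have [FS _ _] := FD.
pose f xi := dotv (rhs D (sx z) xi) (sT z *m dW D *m xi + sp0 z)
             + dotv (cost D xi) (sY z *m xi + sy0 z).
pose g xi := dotv xi (sQ z *m xi) + dotv (sq z) xi + sr z.
have cid : entries_continuous (fun xi : 'cV[R]_k => xi).
  by move=> i j; exact: coord_continuous.
have cf : continuous f.
  apply: continuous_addr; apply: continuous_dotv;
    exact: entries_continuous_affine.
have cg : continuous g.
  apply: continuous_addr; last exact: cst_continuous.
  apply: continuous_addr; apply: continuous_dotv => //.
    by apply: entries_continuousM => //; exact: entries_continuous_cst.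
  exact: entries_continuous_cst.
rewrite (expectation_fineK support_compact FS cf) lee_fin.
apply: le_trans (carried_le_Rintegral support_compact FS cf cg _) _.
  by move=> xi hxi; exact: (sdp_integrand_le X_binary zFM tau0 blk hxi).
have := ambiguity_quadratic_le (sq z) (sr z) support_compact Sigma0_pd
  gamma1_ge0 FD (FM_Q zFM).
(* After r is cancelled, the claim is the inequality constraining t. *)
move=> /le_trans; apply; rewrite -!addrA lerD2l addrA.
exact: FM_t zFM.
Qed.
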